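(* Let $G$ be a finite simple graph for which $\chi(G)=\operatorname{Xind}(\operatorname{Hom}(K_2,G))+2=t$. Assume that $G$ is properly colored with $[t]=\{1,\ldots,t\}$ as the color set and let $I,J\subseteq[t]$ form a bipartition of the color set, i.e., $I\cup J=[t]$ and $I\cap J=\varnothing$. Then there exists a colorful copy of the complete bipartite graph $K_{|I|,|J|}$ in $G$ with the colors in $I$ on one side and the colors in $J$ on the other side.
   Context: A copy of $K_{\ell,m}$ in $G$ is given by disjoint vertex subsets $A,B$ with $|A|=\ell$, $|B|=m$ such that every vertex of $A$ is adjacent to every vertex of $B$ (a not necessarily induced subgraph; one of the sides may be empty). Colorful means that all colors of $[t]$ appear in the subgraph. A free $\mathbb{Z}_2$-poset $P$ is a partially ordered set with a fixed-point free order-preserving automorphism $-:P\to P$ of order $2$. An order-preserving $\mathbb{Z}_2$-map $\phi:P\to Q$ between free $\mathbb{Z}_2$-posets is an order-preserving map with $\phi(-x)=-\phi(x)$ for all $x\in P$. For a nonnegative integer $n$, $Q_n$ is the free $\mathbb{Z}_2$-poset with elements $\{\pm1,\ldots,\pm(n+1)\}$, where $x<_{Q_n}y$ if and only if $|x|<|y|$, with automorphism $x\mapsto -x$. The cross-index $\operatorname{Xind}(P)$ of a free $\mathbb{Z}_2$-poset $P$ is the minimum $n$ such that there is an order-preserving $\mathbb{Z}_2$-map from $P$ to $Q_n$; if $P$ is empty, $\operatorname{Xind}(P)=-1$. For a graph $G=(V,E)$, the Hom complex $\operatorname{Hom}(K_2,G)$ is the free $\mathbb{Z}_2$-poset of all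 pairs $(A,B)$ of nonempty disjoint subsets of $V$ such that every vertex of $A$ is adjacent in $G$ to every vertex of $B$, ordered by $(A,B)\subseteq(A',B')$ if $A\subseteq A'$ and $B\subseteq B'$, with automorphism $-(A,B)=(B,A)$. *)

(* Defs.v *)
From HB Require Import structures.
From mathcomp Require Import all_boot all_order ssralg ssrint.

Set Implicit Arguments.
Unset Strict Implicit.
Unset Printing Implicit Defensive.

Import Order.TTheory.

HB.mixin Record POrder_isFreeZ2 d P of Order.POrder d P := {
  z2opp : P -> P;
  z2oppK : involutive z2opp;
  z2opp_neq : forall x, z2opp x != x;
  z2opp_homo : {homo z2opp : x y / (x <= y)%O}
}.

#[short(type="freeZ2PosetType")]
HB.structure Definition FreeZ2Poset d :=
  {P of POrder_isFreeZ2 d P & Order.POrder d P}.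

#[short(type="finFreeZ2PosetType")]
HB.structure Definition FinFreeZ2Poset d :=
  {P of POrder_isFreeZ2 d P & Order.FinPOrder d P}.

Definition z2map d (P : finFreeZ2PosetType d) d' (Q : freeZ2PosetType d')
    (phi : P -> Q) : bool :=
  [forall x, forall y, (x <= y)%O ==> (phi x <= phi y)%O]
  && [forall x, phi (z2opp x) == z2opp (phi x)].

Lemma z2mapP d (P : finFreeZ2PosetType d) d' (Q : freeZ2PosetType d')
    (phi : P -> Q) :
  reflect ({homo phi : x y / (x <= y)%O} /\ {morph phi : x / z2opp x})
          (z2map phi).
Proof.
apply: (iffP andP) => [[/'forall_'forall_implyP h /'forall_eqP m]|[h m]].
  by split=> [x y|x]; [exact: h | exact: m].
by split; [apply/'forall_'forall_implyP => x y; exact: h | apply/'forall_eqP].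
Qed.

(* QPos b i stands for the element (-1)^b (i + 1) of {±1, ..., ±(n+1)}. *)
Record Qpos (n : nat) := QPos { Qneg : bool; Qidx : 'I_n.+1 }.

Definition Qpos_pair n (x : Qpos n) := (Qneg x, Qidx x).
Definition Qpos_of_pair n (p : bool * 'I_n.+1) := QPos p.1 p.2.

Fact Qpos_pairK n : cancel (@Qpos_pair n) (@Qpos_of_pair n).
Proof. by case. Qed.

HB.instance Definition _ n := Finite.copy (Qpos n) (can_type (@Qpos_pairK n)).

Definition Qabs n (x : Qpos n) : nat := (Qidx x).+1.
Definition Qopp n (x : Qpos n) : Qpos n := QPos (~~ Qneg x) (Qidx x).
Definition Qlt n (x y : Qpos n) : bool := (Qabs x < Qabs y)%N.
Definition Qle n (x y : Qpos n) : bool := (x == y) || Qlt x y.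

Fact Qpos_display : Order.disp_t. Proof. exact: (Order.Disp tt tt). Qed.

Section QposOrder.
Variable n : nat.
Implicit Types x y z : Qpos n.

Fact Qle_def x y : Qle x y = (x == y) || Qlt x y.
Proof. by []. Qed.

Fact Qlt_irr : irreflexive (@Qlt n).
Proof. by move=> x; rewrite /Qlt ltnn. Qed.

Fact Qlt_trans : transitive (@Qlt n).
Proof. by move=> y x z; apply: ltn_trans. Qed.

HB.instance Definition _ :=
  Order.LtLe_isPOrder.Build Qpos_display (Qpos n) Qle_def Qlt_irr Qlt_trans.

Fact QoppK : involutive (@Qopp n).
Proof. by case=> b i; rewrite /Qopp /= negbK. Qed.

Fact Qopp_neq x : Qopp x != x.
Proof. by apply/eqP; case: x => [[] i] []. Qed.

Fact Qopp_homo : {homo @Qopp n : x y / (x <= y)%O}.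
Proof.
move=> x y; rewrite /Order.le /= /Qle => /orP[/eqP->|lt_xy].
  by rewrite eqxx.
by apply/orP; right.
Qed.

HB.instance Definition _ :=
  POrder_isFreeZ2.Build Qpos_display (Qpos n) QoppK Qopp_neq Qopp_homo.

End QposOrder.

Definition has_Qmap d (P : finFreeZ2PosetType d) (n : nat) : bool :=
  [exists phi : {ffun P -> Qpos n}, z2map phi].

Lemma has_Qmap_ex d (P : finFreeZ2PosetType d) : exists n, has_Qmap P n.
Proof.
pose rk (x : P) := #|[set y : P | (y < x)%O]|.
have rkS x : (rk x < #|P|.+1)%N by rewrite ltnS max_card.
have rk_lt x y : (x < y)%O -> (rk x < rk y)%N.
  move=> lt_xy; apply/proper_card/properP; split.
    by apply/subsetP => z; rewrite !inE => /lt_trans; apply.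
  by exists x; rewrite !inE ?ltxx.
have opp_lt (x y : P) : (x < y)%O -> (z2opp x < z2opp y)%O.
  move=> lt_xy; rewrite lt_neqAle z2opp_homo ?(ltW lt_xy) // andbT.
  by rewrite (inj_eq (inv_inj z2oppK)) (lt_eqF lt_xy).
have rk_opp x : rk (z2opp x) = rk x.
  rewrite /rk -(card_imset [set y : P | (y < x)%O] (inv_inj (@z2oppK _ P))).
  congr #|pred_of_set _|; apply/setP => y; rewrite inE.
  apply/idP/imsetP => [lt_yx|[z]]; last by rewrite inE => /opp_lt lt_zx ->.
  by exists (z2opp y); rewrite ?z2oppK // inE -(z2oppK x) opp_lt.
pose sg (x : P) : bool := (enum_rank x < enum_rank (z2opp x))%N.
exists #|P|; apply/existsP.
exists [ffun x => QPos (sg x) (Ordinal (rkS x))].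
apply/z2mapP; split=> [x y|x]; rewrite !ffunE.
  rewrite le_eqVlt => /orP[/eqP->//|/rk_lt lt_xy].
  by apply/ltW; rewrite /Order.lt /= /Qlt /Qabs /= ltnS.
rewrite /z2opp /= /Qopp /=; congr QPos; last by apply/val_inj/rk_opp.
rewrite /sg z2oppK -leqNgt [RHS]leq_eqVlt.
case: eqP => // /ord_inj/enum_rank_inj eq_x.
by have := z2opp_neq x; rewrite eq_x eqxx.
Qed.

Definition Xind d (P : finFreeZ2PosetType d) : int :=
  if #|P| == 0 then (-1)%R else Posz (ex_minn (has_Qmap_ex P)).

Record sgraph := SGraph {
  vertex :> finType;
  adj : rel vertex;
  adj_sym : symmetric adj;
  adj_irr : irreflexive adj
}.

Definition proper_coloring (G : sgraph) (C : eqType) (c : G -> C) : bool :=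
  [forall x, forall y, adj x y ==> (c x != c y)].

Definition colorable (G : sgraph) (k : nat) : bool :=
  [exists c : {ffun G -> 'I_k}, proper_coloring c].

Lemma colorable_ex (G : sgraph) : exists k, colorable G k.
Proof.
exists #|G|; apply/existsP; exists [ffun x => enum_rank x].
apply/'forall_'forall_implyP => x y xy; rewrite !ffunE (inj_eq enum_rank_inj).
by apply: contraTneq xy => ->; rewrite adj_irr.
Qed.

Definition chromatic_number (G : sgraph) : nat := ex_minn (colorable_ex G).

Definition complete_between (G : sgraph) (A B : {set G}) : bool :=
  [forall x in A, forall y in B, adj x y].

Definition homK2_pred (G : sgraph) (AB : {set G} * {set G}) : bool :=
  [&& AB.1 != set0, AB.2 != set0, [disjoint AB.1 & AB.2]
    & complete_between AB.1 AB.2].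

Record HomK2 (G : sgraph) := HomK2Pair {
  homK2_val :> {set G} * {set G};
  _ : homK2_pred homK2_val
}.

HB.instance Definition _ G := [isSub for @homK2_val G].
HB.instance Definition _ G := [Finite of HomK2 G by <:].

Definition HomK2_le (G : sgraph) (x y : HomK2 G) : bool :=
  ((val x).1 \subset (val y).1) && ((val x).2 \subset (val y).2).

Fact HomK2_display : Order.disp_t. Proof. exact: (Order.Disp tt tt). Qed.

Section HomK2Order.
Variable G : sgraph.

Fact HomK2_le_refl : reflexive (@HomK2_le G).
Proof. by move=> x; rewrite /HomK2_le !subxx. Qed.

Fact HomK2_le_anti : antisymmetric (@HomK2_le G).
Proof.
move=> x y /andP[/andP[xy1 xy2] /andP[yx1 yx2]]; apply: val_inj.
rewrite [val x]surjective_pairing [val y]surjective_pairing.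
by congr pair; apply/eqP; rewrite eqEsubset ?xy1 ?xy2.
Qed.

Fact HomK2_le_trans : transitive (@HomK2_le G).
Proof.
move=> y x z /andP[xy1 xy2] /andP[yz1 yz2].
by rewrite /HomK2_le (subset_trans xy1) ?(subset_trans xy2).
Qed.

HB.instance Definition _ := Order.Le_isPOrder.Build HomK2_display (HomK2 G)
  HomK2_le_refl HomK2_le_anti HomK2_le_trans.

End HomK2Order.

Lemma HomK2_leE (G : sgraph) (x y : HomK2 G) :
  (x <= y)%O = ((val x).1 \subset (val y).1) && ((val x).2 \subset (val y).2).
Proof. by []. Qed.

Section HomK2Z2.
Variable G : sgraph.

Fact HomK2_swap_subproof (x : HomK2 G) :
  homK2_pred ((val x).2, (val x).1).
Proof.
case: x => -[A B] /= /and4P[/= A0 B0 dAB /'forall_in_forall_inP cAB].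
apply/and4P; split=> //; first by rewrite disjoint_sym.
by apply/'forall_in_forall_inP => y z yB zA; rewrite adj_sym cAB.
Qed.

Definition HomK2_swap (x : HomK2 G) : HomK2 G :=
  HomK2Pair (HomK2_swap_subproof x).

Fact HomK2_swapK : involutive HomK2_swap.
Proof. by move=> x; apply: val_inj; case: x => -[]. Qed.

Fact HomK2_swap_neq x : HomK2_swap x != x.
Proof.
apply/eqP => /(congr1 val); case: x => -[A B] /= /and4P[A0 _ dAB _] [eBA _].
by move: dAB; rewrite eBA -setI_eq0 setIid (negPf A0).
Qed.

Fact HomK2_swap_homo : {homo HomK2_swap : x y / (x <= y)%O}.
Proof. by move=> x y; rewrite !HomK2_leE /= andbC. Qed.

HB.instance Definition _ := POrder_isFreeZ2.Build HomK2_display (HomK2 G)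
  HomK2_swapK HomK2_swap_neq HomK2_swap_homo.

End HomK2Z2.

Definition Kcopy (G : sgraph) (l m : nat) (A B : {set G}) : bool :=
  [&& [disjoint A & B], #|A| == l, #|B| == m & complete_between A B].

Definition colorful (G : sgraph) (C : finType) (c : G -> C) (S : {set G}) :=
  c @: S == [set: C].

(* Main.v *)
(** Given any sign on a free Z2-poset [P] that is reversed by the involution,
    sending [x] to its sign and the maximal length of a sign-alternating chain
    ending at [x] is an order-preserving Z2-map to some [Q_n]. Hence [P] contains
    an alternating chain with [Xind P + 1] elements.

    Order the colors so that the last two lie on different sides of the
    bipartition, and let the sign of [(A, B)] record the side of the smallest
    color occurring in [(A, B)], twisted by a fixed sign for each color. Along an
    alternating chain the smallest color strictly decreases. As the bottom pair
    already has two colors, a chain of [t - 1] elements has to start with the last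
    two colors on different sides and then add all others one by one in decreasing
    order, each on a side forced by alternation. The twist is chosen so that
    these sides are those of the bipartition [(I, J)], up to a global exchange.
    When [I] or [J] is empty, it suffices that all [t] colors are used. *)

Require Import Defs.
From mathcomp Require Import all_boot all_order ssralg ssrint.
From mathcomp Require Import perm zify.

Set Implicit Arguments.
Unset Strict Implicit.
Unset Printing Implicit Defensive.

Import Order.TTheory.

(** * Alternating chains in a free Z2-poset *)

Section AlternatingChains.
Variables (d : Order.disp_t) (P : finFreeZ2PosetType d) (s : P -> bool).

(* [alt_chain k x]: some alternating chain of [k.+1] elements has maximum [x]. *)
Fixpoint alt_chain (k : nat) (x : P) : bool :=
  if k is k'.+1 then [exists y, [&& (y < x)%O, s y != s x & alt_chain k' y]]
  else true.

Lemma alt_chain_lt k x y :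
  (x < y)%O -> s x != s y -> alt_chain k x -> alt_chain k.+1 y.
Proof. by move=> xy sxy kx; apply/existsP; exists x; apply/and3P. Qed.

Lemma alt_chain_le k x y :
  (x <= y)%O -> s x = s y -> alt_chain k x -> alt_chain k y.
Proof.
case: k => //= k xy sxy /existsP[z /and3P[zx szx kz]].
by apply/existsP; exists z; rewrite (lt_le_trans zx xy) -sxy szx.
Qed.

Hypothesis s_opp : forall x, s (z2opp x) = ~~ s x.

Lemma z2opp_lt (x y : P) : (x < y)%O -> (z2opp x < z2opp y)%O.
Proof.
move=> xy; rewrite lt_neqAle z2opp_homo ?(ltW xy) // andbT.
by rewrite (inj_eq (inv_inj z2oppK)) (lt_eqF xy).
Qed.

Lemma alt_chain_opp k x : alt_chain k x -> alt_chain k (z2opp x).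
Proof.
elim: k x => //= k IHk x /existsP[y /and3P[yx syx ky]].
apply/existsP; exists (z2opp y); rewrite z2opp_lt // IHk // !s_opp.
by rewrite (inj_eq negb_inj) syx.
Qed.

Lemma no_alt_chain_has_Qmap n :
  (forall x, ~~ alt_chain n.+1 x) -> has_Qmap P n.
Proof.
move=> noalt.
pose l (x : P) : 'I_n.+1 := [arg max_(k > ord0 | alt_chain k x) (k : nat)].
have lP x : alt_chain (l x) x by rewrite /l; case: arg_maxnP.
have l_max x k : alt_chain k x -> (k <= n)%N -> (k <= l x)%N.
  rewrite -ltnS => kx lt_kn; rewrite /l; case: arg_maxnP => //= i _ i_max.
  exact: (i_max (Ordinal lt_kn)).
have l_le x : (l x <= n)%N by rewrite -ltnS.
apply/existsP; exists [ffun x => QPos (s x) (l x)].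
apply/z2mapP; split=> [x y|x]; rewrite !ffunE.
  rewrite le_eqVlt => /predU1P[->//|xy].
  rewrite /Order.le /= /Qle /Qlt /Qabs /= ltnS.
  have [sxy|sxy] := eqVneq (s x) (s y).
    have := l_max _ _ (alt_chain_le (ltW xy) sxy (lP x)) (l_le x).
    rewrite leq_eqVlt => /predU1P[/val_inj lxy|->]; last exact: orbT.
    by rewrite sxy lxy eqxx.
  have lSy := alt_chain_lt xy sxy (lP x).
  (* [l] only sees chains of index at most [n]; [noalt] ensures that this cap does not hide the
     chain extended to [y]. *)
  have: (l x < n)%N.
    rewrite ltn_neqAle l_le andbT; apply/eqP => lxn.
    by move: lSy; rewrite lxn; apply/negP/noalt.
  by move=> /(l_max _ _ lSy) ->; rewrite orbT.
have l_opp : l (z2opp x) = l x.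
  apply/val_inj/eqP; rewrite eqn_leq; apply/andP.
  split; apply: l_max (l_le _); last exact: alt_chain_opp.
  by have := alt_chain_opp (lP (z2opp x)); rewrite z2oppK.
by rewrite s_opp l_opp.
Qed.

Lemma Xind_alt_chain n : Xind P = Posz n -> exists x, alt_chain n x.
Proof.
rewrite /Xind; case: eqP => // /eqP; rewrite -lt0n => /card_gt0P[x _].
case: n => [|n] [min_n]; first by exists x.
(* Without such a chain there would be a map to [Qpos n], below the minimum [n.+1]. *)
apply/existsP; apply: contraT; rewrite negb_exists => /forallP noalt.
move: min_n; case: ex_minnP => m _ m_min mE.
by have := m_min _ (no_alt_chain_has_Qmap noalt); rewrite mE ltnn.
Qed.

End AlternatingChains.

(** * Color representatives and surjectivity of optimal colorings *)

Lemma imset_section (T C : finType) (f : T -> C) (A : {set T}) :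
  exists A' : {set T}, [/\ A' \subset A, f @: A' = f @: A & #|A'| = #|f @: A|].
Proof.
(* [r x] depends only on [f x], so its fixed points contain exactly one element of each fiber met by
   [A]. *)
pose r x := [pick y in A | f y == f x].
pose A' := [set x in A | r x == Some x].
have sA'A : A' \subset A by apply/subsetP => x; rewrite inE => /andP[].
have fA' : f @: A' = f @: A.
  apply/eqP; rewrite eqEsubset imsetS //; apply/subsetP => _ /imsetP[x xA ->].
  case rx: (r x) => [y|]; last first.
    by move: rx; rewrite /r; case: pickP => // /(_ x); rewrite xA eqxx.
  have /andP[yA /eqP fyx] : (y \in A) && (f y == f x).
    by move: rx; rewrite /r; case: pickP => // z zP [<-].
  by rewrite -fyx imset_f // inE yA -rx /r fyx eqxx.
exists A'; split=> //; rewrite -fA' card_in_imset // => x y.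
rewrite !inE => /andP[_ /eqP rx] /andP[_ /eqP ry] fxy.
by apply: Some_inj; rewrite -rx -ry /r fxy.
Qed.

Lemma Kcopy_of_complete (G : sgraph) (C : finType) (c : G -> C)
    (A B : {set G}) (I J : {set C}) :
  [disjoint A & B] -> complete_between A B -> c @: A = I -> c @: B = J ->
  I :|: J = [set: C] ->
  exists A B : {set G},
    [/\ Kcopy #|I| #|J| A B, colorful c (A :|: B), c @: A = I & c @: B = J].
Proof.
move=> dAB cAB cA cB IUJ.
have [A' [sA fA nA]] := imset_section c A.
have [B' [sB fB nB]] := imset_section c B.
exists A', B'; rewrite /colorful imsetU fA fB cA cB IUJ; split=> //.
apply/and4P; split; rewrite ?nA ?nB ?cA ?cB //.
  by rewrite (disjointWl sA) // (disjointWr sB).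
apply/'forall_in_forall_inP => x /(subsetP sA) xA y /(subsetP sB) yB.
by move/'forall_in_forall_inP: cAB; apply.
Qed.

Lemma chromatic_coloring_surj (G : sgraph) (t : nat) (c : G -> 'I_t) :
  chromatic_number G = t -> proper_coloring c -> c @: [set: G] = [set: 'I_t].
Proof.
rewrite /chromatic_number; case: ex_minnP => m _ m_min mE.
rewrite {m}mE in m_min.
case: t => [|t] in c m_min *; first by move=> _; apply/setP => -[].
move=> /'forall_'forall_implyP c_proper; apply/eqP.
rewrite eqEsubset subsetT; apply/subsetP => i _; apply: contraT => iNc.
have c_neq v : i != c v.
  by apply: contraNneq iNc => ->; rewrite imset_f.
have : colorable G t; last by move/m_min; rewrite ltnn.
have c'P v : {j : 'I_t | c v = lift i j}.
  by have [j cv _] := unlift_some (c_neq v); exists j.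
apply/existsP; exists [ffun v => sval (c'P v)].
apply/'forall_'forall_implyP => x y /c_proper; rewrite !ffunE.
by case: (c'P x) (c'P y) => [j cx] [k cy]; rewrite /= cx cy (inj_eq lift_inj).
Qed.

(** * Signs on the Hom complex, with colors ranked by [s] *)

Section ColorSigns.
Variables (G : sgraph) (n : nat) (c : G -> 'I_n.+2).
Hypothesis c_proper : proper_coloring c.
Variables (I : {set 'I_n.+2}) (s : {perm 'I_n.+2}).

Implicit Types x y : HomK2 G.

Let X x := c @: (val x).1.
Let Y x := c @: (val x).2.

Lemma HomK2_colors_disjoint x i : i \in X x -> i \in Y x -> False.
Proof.
have /and4P[_ _ _ /'forall_in_forall_inP cAB] := valP x.
move=> /imsetP[v vA ->] /imsetP[w wB /eqP].
by apply/negP; have /'forall_'forall_implyP := c_proper; apply; exact: cAB.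
Qed.

Lemma HomK2_colors_neq0 x : (X x != set0) /\ (Y x != set0).
Proof. by rewrite !imset_eq0; have /and4P[] := valP x. Qed.

Lemma s_neq i j : i != j -> s i != s j :> nat.
Proof. by rewrite (inj_eq val_inj) (inj_eq perm_inj). Qed.

Definition supp x := X x :|: Y x.

Definition min_color x : 'I_n.+2 :=
  let i0 := xchoose (set0Pn _ (HomK2_colors_neq0 x).1) in
  [arg min_(i < i0 in supp x) (s i : nat)].

Lemma min_colorP x :
  min_color x \in supp x /\ (forall i, i \in supp x -> s (min_color x) <= s i).
Proof.
rewrite /min_color; case: arg_minnP => //.
by rewrite inE (xchooseP (set0Pn _ _)).
Qed.

Lemma min_color_in x : min_color x \in supp x.
Proof. by case: (min_colorP x). Qed.

Lemma min_color_le x i : i \in supp x -> s (min_color x) <= s i.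
Proof. by case: (min_colorP x) => _; apply. Qed.

Lemma min_color_uniq x i :
  i \in supp x -> (forall j, j \in supp x -> s i <= s j) -> min_color x = i.
Proof.
move=> i_x i_min; apply/(@perm_inj _ s)/val_inj/eqP.
by rewrite eqn_leq min_color_le //= i_min ?min_color_in.
Qed.

Lemma supp_inY x i : i \in supp x -> (i \in Y x) = (i \notin X x).
Proof.
rewrite inE; have := @HomK2_colors_disjoint x i.
by case: (i \in X x) (i \in Y x) => [] [] // /(_ isT isT).
Qed.

Lemma X_mono x y : (x <= y)%O -> X x \subset X y.
Proof. by rewrite HomK2_leE => /andP[? _]; apply: imsetS. Qed.

Lemma Y_mono x y : (x <= y)%O -> Y x \subset Y y.
Proof. by rewrite HomK2_leE => /andP[_ ?]; apply: imsetS. Qed.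

Lemma supp_mono x y : (x <= y)%O -> supp x \subset supp y.
Proof. by move=> xy; apply: setUSS; [apply: X_mono|apply: Y_mono]. Qed.

(** A present color occurs on one side only, and enlarging the pair cannot move it. *)
Lemma supp_inX_le x y i :
  (x <= y)%O -> i \in supp x -> (i \in X y) = (i \in X x).
Proof.
move=> xy i_x; have i_y := subsetP (supp_mono xy) _ i_x.
have [iX|] := boolP (i \in X x); first by rewrite (subsetP (X_mono xy)).
by rewrite -supp_inY // => /(subsetP (Y_mono xy)); rewrite supp_inY // => /negbTE.
Qed.

(** Parity changes between consecutive ranks, so signs that alternate down the ranks keep
    [(i \in X x) (+) (i \in I)] constant. *)
Definition color_sign x : bool :=
  let i := min_color x in (i \in X x) (+) (i \in I) (+) odd (s i).

Lemma color_sign_opp x : color_sign (z2opp x) = ~~ color_sign x.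
Proof.
have supp_opp : supp (z2opp x) = supp x by rewrite /supp setUC.
have min_opp : min_color (z2opp x) = min_color x.
  apply: min_color_uniq; rewrite supp_opp ?min_color_in // => j.
  exact: min_color_le.
rewrite /color_sign min_opp -[_ \in X (z2opp x)]/(_ \in Y x).
by rewrite supp_inY ?min_color_in // !addNb.
Qed.

(** If the minimum did not drop, the smallest color would be the same, on the same side, and so
    would the sign. *)
Lemma color_sign_neq_lt x y :
  (x <= y)%O -> color_sign x != color_sign y ->
  s (min_color y) < s (min_color x).
Proof.
move=> xy; apply: contraNltn => le_xy.
have min_y : min_color y = min_color x.
  apply: min_color_uniq => [|j /min_color_le]; last exact: leq_trans.
  exact: (subsetP (supp_mono xy)) (min_color_in _).
by rewrite /color_sign min_y (supp_inX_le xy) ?min_color_in.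
Qed.

(** The bottom pair may hold both top colors at once, so no alternation relates their sides. *)
Hypothesis top_split :
  forall i j, s i = n :> nat -> s j = n.+1 :> nat -> (j \in I) = (i \notin I).

(** Two distinct colors at the bottom force a minimum of at most [n], and each step lowers it.
    Equality means drops of exactly one, so no rank is skipped. *)
Lemma color_alt_chain k x : alt_chain color_sign k x ->
  let m := s (min_color x) in
  m + k <= n /\
  (m + k = n -> forall i, m <= s i ->
    i \in supp x /\ (i \in X x) = (i \in I) (+) color_sign x (+) odd m).
Proof.
elim: k x => [|k IHk] x /=; rewrite ?addn0.
  move=> _; have [/set0Pn[a aX] /set0Pn[b bY]] := HomK2_colors_neq0 x.
  have ax : a \in supp x by rewrite inE aX.
  have bx : b \in supp x by rewrite inE bY orbT.
  have sab : s a != s b :> nat.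
    apply/eqP => /val_inj/perm_inj ab.
    by apply: (HomK2_colors_disjoint aX); rewrite ab.
  have [ma mb] := (min_color_le ax, min_color_le bx).
  have [la lb] := (ltn_ord (s a), ltn_ord (s b)).
  split=> [|mn]; first lia.
  have ab_top i : n <= s i -> i = a \/ i = b.
    move=> ni; have li := ltn_ord (s i).
    have [->|ia] := eqVneq i a; first by left.
    have [->|ib] := eqVneq i b; first by right.
    have sia : s i != s a :> nat by rewrite s_neq.
    have sib : s i != s b :> nat by rewrite s_neq.
    lia.
  have /negbTE bX : b \notin X x by rewrite -supp_inY ?bY.
  rewrite mn /color_sign mn => i /ab_top i_ab.
  have [|mE|mE] := ab_top (min_color x); first by rewrite mn.
    have sa : s a = n :> nat by rewrite -mE.
    have sb : s b = n.+1 :> nat by lia.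
    rewrite mE; case: i_ab => ->; rewrite aX ?bX ?(top_split sa sb);
      split=> //; by case: (a \in I) (odd n) => [] [].
  have sb : s b = n :> nat by rewrite -mE.
  have sa : s a = n.+1 :> nat by lia.
  rewrite mE; case: i_ab => ->; rewrite bX ?aX ?(top_split sb sa);
    split=> //; by case: (b \in I) (odd n) => [] [].
case/existsP=> y /and3P[yx syx /IHk/= [le_n IHy]].
have lt_m := color_sign_neq_lt (ltW yx) syx.
split=> [|mn i mi]; first lia.
have myn : s (min_color y) + k = n by lia.
have my : s (min_color y) = (s (min_color x)).+1 :> nat by lia.
have sgn : color_sign y = ~~ color_sign x.
  by case: color_sign syx; case: color_sign.
have [->|im] := eqVneq i (min_color x).
  split; first exact: min_color_in.
  by rewrite /color_sign; case: (_ \in _) (_ \in _) (odd _) => [] [] [].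
have sim : s i != s (min_color x) :> nat by rewrite s_neq.
have [|iy iXy] := IHy myn i; first lia.
split; first exact: (subsetP (supp_mono (ltW yx))).
rewrite (supp_inX_le (ltW yx)) // iXy sgn my /=.
(* From [y] to [x] both the sign and the parity of the minimum flip, and the flips cancel. *)
by case: (i \in I) (color_sign x) (odd _) => [] [] [].
Qed.

End ColorSigns.

(** * Choice of the ranking and extraction of the copy *)

Lemma exists_perm_last2 n (i j : 'I_n.+2) : i != j ->
  exists s : {perm 'I_n.+2}, s i = n :> nat /\ s j = n.+1 :> nat.
Proof.
move=> ij; pose s1 := tperm j ord_max.
have s1i : s1 i != ord_max.
  by rewrite -[X in _ != X](tpermL j) (inj_eq perm_inj).
(* [s1] sends [j] to the last rank; the second transposition fixes that rank and sends the image of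
   [i] to [n]. *)
exists (s1 * tperm (s1 i) (inord n))%g; rewrite !permM tpermL inordK //.
by rewrite [s1 j]tpermL tpermD // -val_eqE /= inordK // neq_ltn leqnn.
Qed.

Theorem theorem4 (G : sgraph) (t : nat)
    (chi_t : chromatic_number G = t)
    (Xind_t : (Xind (HomK2 G) + 2)%R = Posz t)
    (c : G -> 'I_t) (c_proper : proper_coloring c)
    (I J : {set 'I_t}) (IUJ : I :|: J = [set: 'I_t]) (IIJ : I :&: J = set0) :
  exists A B : {set G},
    [/\ Kcopy #|I| #|J| A B, colorful c (A :|: B),
        c @: A = I & c @: B = J].
Proof.
have c_surj := chromatic_coloring_surj chi_t c_proper.
have [I0|/set0Pn[i iI]] := eqVneq I set0.
  apply: (@Kcopy_of_complete _ _ _ set0 setT) => //.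
  - by rewrite -setI_eq0 set0I.
  - by apply/'forall_in_forall_inP => x; rewrite inE.
  - by rewrite imset0.
  - by rewrite c_surj -IUJ I0 set0U.
have [J0|/set0Pn[j jJ]] := eqVneq J set0.
  apply: (@Kcopy_of_complete _ _ _ setT set0) => //.
  - by rewrite -setI_eq0 setI0.
  - by apply/'forall_in_forall_inP => x _ y; rewrite inE.
  - by rewrite c_surj -IUJ J0 setU0.
  - by rewrite imset0.
have J_I k : (k \in J) = (k \notin I).
  have := in_setT k; rewrite -IUJ inE; have := in_set0 k; rewrite -IIJ inE.
  by case: (k \in I) (k \in J) => [] [].
have ij : i != j by apply: contraTneq jJ => <-; rewrite J_I iI.
case: t => [|[|n]] in chi_t Xind_t c c_proper c_surj I J IUJ IIJ i j iI jJ J_I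
                      ij *.
- by case: i {iI ij}.
- by move: ij; rewrite (ord1 i) (ord1 j) eqxx.
have XindE : Xind (HomK2 G) = Posz n by lia.
have [s [si sj]] := exists_perm_last2 ij.
have top_split a b :
    s a = n :> nat -> s b = n.+1 :> nat -> (b \in I) = (a \notin I).
  move=> sa sb.
  have -> : a = i by apply/(@perm_inj _ s)/val_inj; rewrite /= sa si.
  have -> : b = j by apply/(@perm_inj _ s)/val_inj; rewrite /= sb sj.
  by rewrite iI; apply/negbTE; rewrite -J_I.
have [x /(color_alt_chain c_proper top_split)[]] :=
  Xind_alt_chain (@color_sign_opp _ _ _ c_proper I s) XindE.
set m := s _; rewrite /= => le_n.
(* The bound [m + n <= n] is attained, so the pattern covers every color. *)
have m0 : m = 0 :> nat by lia.
rewrite m0 add0n => /(_ erefl) pattern.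
have YE k : (k \in c @: (val x).2) = (k \notin c @: (val x).1).
  by apply: (supp_inY c_proper); have [] := pattern k.
have /and4P[_ _ dAB cAB] := valP x.
(* A true sign means that the first side carries [J]; the two sides are then exchanged. *)
case: (color_sign c I s x) pattern => pattern.
  have cA : c @: (val x).1 = J.
    by apply/setP => k; have [//|_ ->] := pattern k; rewrite J_I addbT addbF.
  have cB : c @: (val x).2 = I.
    by apply/setP => k; rewrite YE cA J_I negbK.
  apply: (Kcopy_of_complete _ _ cB cA IUJ); first by rewrite disjoint_sym.
  apply/'forall_in_forall_inP => v vB w wA; rewrite adj_sym.
  by move/'forall_in_forall_inP: cAB; apply.
have cA : c @: (val x).1 = I.
  by apply/setP => k; have [//|_ ->] := pattern k; rewrite !addbF.
have cB : c @: (val x).2 = J by apply/setP => k; rewrite YE cA J_I.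
exact: Kcopy_of_complete dAB cAB cA cB IUJ.
Qed.
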